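(* Let $\lambda\in\mathbb R_+$ and $j\in\mathbb N_0=\{0,1,2,\dots\}$. Then the sequence of monic Sobolev-type Meixner polynomials, orthogonal with respect to the inner product $\langle f,g\rangle_{\lambda,j,\ell}=\langle\mathbf u,fg\rangle+\lambda\,\mathcal T^jf(\alpha)\,\mathcal T^jg(\alpha)$, satisfies the following $(2j+3)$-term recurrence relation: for $\ell=1$, $$(x-\alpha)_{j+1}\,\mathcal M^{j,1}_n(x;\beta,c;\lambda)=\mathcal M^{j,1}_{n+j+1}(x;\beta,c;\lambda)+\sum_{k=n-j-1}^{n+j}c_{n,k}^{j,1}\,\mathcal M^{j,1}_k(x;\beta,c;\lambda),$$ and for $\ell=2$, $$(x-\alpha-j)_{j+1}\,\mathcal M^{j,2}_n(x;\beta,c;\lambda)=\mathcal M^{j,2}_{n+j+1}(x;\beta,c;\lambda)+\sum_{k=n-j-1}^{n+j}c_{n,k}^{j,2}\,\mathcal M^{j,2}_k(x;\beta,c;\lambda),$$ where the constant coefficients $c_{n,k}^{j,\ell}$ can be explicitly computed for $\ell=1,2$ (terms with $k<0$ are absent from the sums).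
   Context: Parameters: $\beta,c$ are complex numbers with $c\neq0,1$ and $\beta$ not a negative integer; $\alpha\le0$. Notation: $(a)_k=a(a+1)\cdots(a+k-1)$, $(a)_0=1$; $\Delta f(x)=f(x+1)-f(x)$, $\nabla f(x)=f(x)-f(x-1)$, with zeroth powers equal to the identity. The monic Meixner polynomials are $M_n(x;\beta,c)=\frac{c^n\,n!}{(1-c)^n}\sum_{i=0}^n c^{-i}\binom{x}{i}\binom{-x-\beta}{n-i}$. The Meixner functional $\mathbf u$ is the linear functional on polynomials with respect to which they are orthogonal, with $\langle\mathbf u,M_n^2\rangle=\frac{(\beta)_nc^nn!}{(1-c)^{\beta+2n}}$; when $\beta>0$ and $0<c<1$ it is $\langle \mathbf u,f\rangle=\sum_{x=0}^\infty\frac{(\beta)_x}{x!}c^xf(x)$. For $\ell\in\{1,2\}$ let $\mathcal T=\nabla$ if $\ell=1$ and $\mathcal T=\Delta$ if $\ell=2$. The Sobolev-type Meixner polynomials $\mathcal M^{j,\ell}_n(x;\beta,c;\lambda)$, $n\ge0$, are the monic polynomials ($\deg=n$) orthogonal with respect to $\langle f,g\rangle_{\lambda,j,\ell}$ above. *)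

(* Defs.v *)
From HB Require Import structures.
From mathcomp Require Import all_boot all_order all_algebra.
From mathcomp Require Import all_classical all_reals all_analysis.
From mathcomp Require Export complex.

Set Implicit Arguments.
Unset Strict Implicit.
Unset Printing Implicit Defensive.

Import Order.TTheory GRing.Theory Num.Theory.

Local Open Scope ring_scope.
Local Open Scope complex_scope.

Definition pochhammer (A : comNzRingType) (a : A) (k : nat) : A :=
  \prod_(i < k) (a + i%:R).

Section ComplexPower.
Variable R : realType.

Definition cexp (z : R[i]) : R[i] :=
  (expR (complex.Re z))%:C
    * (cos (complex.Im z) +i* sin (complex.Im z)).

(* Principal argument, with values in ]-pi, pi]; only meaningful for z != 0. *)
Definition carg (z : R[i]) : R :=
  let t := acos (complex.Re z / ComplexField.Normc.normc z) in
  if 0 <= complex.Im z then t else - t.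

Definition clog (z : R[i]) : R[i] :=
  ln (ComplexField.Normc.normc z) +i* carg z.

(* Principal branch of z ^ w; only meaningful for z != 0. *)
Definition cpow (z w : R[i]) : R[i] := cexp (w * clog z).

End ComplexPower.

Section Meixner.
Variable K : fieldType.

(* binomial(q, i) = q (q - 1) ... (q - i + 1) / i!, for a polynomial q in x. *)
Definition binomial_poly (q : {poly K}) (i : nat) : {poly K} :=
  (i`!%:R)^-1 *: \prod_(k < i) (q - k%:R).

Definition meixner (beta c : K) (n : nat) : {poly K} :=
  (c ^+ n * n`!%:R / (1 - c) ^+ n) *:
    \sum_(i < n.+1)
      c ^- i *: (binomial_poly 'X i * binomial_poly (- 'X - beta%:P) (n - i)).

Definition forward_diff (f : K -> K) : K -> K := fun x => f (x + 1) - f x.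

Definition backward_diff (f : K -> K) : K -> K := fun x => f x - f (x - 1).

Definition sobolev_form (u : {scalar {poly K}}) (T : (K -> K) -> (K -> K))
    (lambda alpha : K) (j : nat) (f g : {poly K}) : K :=
  u (f * g)
    + lambda * iter j T (horner f) alpha * iter j T (horner g) alpha.

(* Bilinear forms over an arbitrary field need not be definite, so the usual
   requirement that the squared norms do not vanish is explicit. *)
Definition monic_orthogonal (B : {poly K} -> {poly K} -> K)
    (P : nat -> {poly K}) : Prop :=
  [/\ forall n, P n \is monic /\ size (P n) = n.+1,
      forall m n, m != n -> B (P m) (P n) = 0
    & forall n, B (P n) (P n) != 0].

(* Summation from n - j.+1, truncated at 0, leaves out negative indices. *)
Definition recurrence (phi : {poly K}) (j : nat) (P : nat -> {poly K})
    (coef : nat -> nat -> K) : Prop :=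
  forall n : nat,
    phi * P n = P (n + j.+1)%N
      + \sum_(n - j.+1 <= k < (n + j).+1) coef n k *: P k.

Definition fourier_coef (B : {poly K} -> {poly K} -> K) (phi : {poly K})
    (P : nat -> {poly K}) (n k : nat) : K :=
  B (phi * P n) (P k) / B (P k) (P k).

End Meixner.

Definition meixner_functional (R : realType) (beta c : R[i])
    (u : {scalar {poly R[i]}}) : Prop :=
  forall m n : nat,
    u (meixner beta c m * meixner beta c n) =
    if m == n then
      pochhammer beta n * c ^+ n * n`!%:R / cpow (1 - c) (beta + (2 * n)%:R)
    else 0.

(* Main.v *)
Require Import Defs.
From mathcomp Require Import all_boot all_order all_algebra.
From mathcomp Require Import all_classical all_reals all_analysis.
From mathcomp Require Import ring.

(** Multiplication by phi is symmetric for the Sobolev form: the operator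
    iterated j times reads a function only at j + 1 consecutive points, from
    alpha - j to alpha for the backward difference and from alpha to alpha + j
    for the forward one, and these are exactly the roots of phi
    ([iter_difference_eq0]).  Hence the discrete term of B (phi f, g) vanishes
    and B (phi f, g) = u (phi f g) = B (f, phi g).

    The recurrence then follows as for classical orthogonal polynomials
    ([symmetric_multiplication_recurrence]).  Since phi is monic of degree
    j + 1, the polynomial phi P_n - P_(n+j+1) has degree at most n + j, so it is
    the sum of its Fourier components along P_0, ..., P_(n+j).  The component
    along P_k is governed by B (phi P_n, P_k) = B (phi P_k, P_n), which is zero
    for k + j + 1 < n because P_n is orthogonal to all polynomials of lower
    degree. *)

Import Order.TTheory GRing.Theory Num.Theory.

Local Open Scope ring_scope.
Local Open Scope complex_scope.

Section OrthogonalExpansion.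
Set Implicit Arguments.
Unset Strict Implicit.
Variables (K : fieldType) (B : {poly K} -> {poly K} -> K).
Variable P : nat -> {poly K}.
Hypothesis B_linearl : forall g, scalar (B^~ g).
Hypothesis P_orth : monic_orthogonal B P.

Lemma size_sub_lead_scale m (f : {poly K}) :
  (size f <= m.+1)%N -> (size (f - f`_m *: P m)%R <= m)%N.
Proof.
case: P_orth => /(_ m) [mon szP] _ _ szf.
apply/leq_sizeP => i; rewrite leq_eqVlt => /predU1P [<- | lt_mi].
  have lead1 : (P m)`_m = 1 by move/monicP: mon; rewrite /lead_coef szP.
  by rewrite coefB coefZ lead1 mulr1 subrr.
have Pi0 : (P m)`_i = 0 by rewrite nth_default // szP.
by rewrite coefB coefZ Pi0 mulr0 subr0 nth_default // (leq_trans szf).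
Qed.

Lemma linearl0 g : B 0 g = 0.
Proof. by have := B_linearl g (-1) 0 0; rewrite scaler0 addr0 mulN1r addNr. Qed.

Lemma orthogonal_lower_degree m k (f : {poly K}) :
  (size f <= m)%N -> (m <= k)%N -> B f (P k) = 0.
Proof.
elim: m f => [|m IHm] f szf le_mk.
  by move: szf; rewrite leqn0 size_poly_eq0 => /eqP ->; rewrite linearl0.
rewrite -(subrK (f`_m *: P m) f) addrC B_linearl.
rewrite (IHm _ (size_sub_lead_scale szf) (ltnW le_mk)) addr0.
case: P_orth => _ Porth _.
by rewrite Porth ?mulr0 // neq_ltn le_mk.
Qed.

Lemma orthogonal_expansion m (f : {poly K}) :
  (size f <= m)%N ->
  f = \sum_(0 <= k < m) (B f (P k) / B (P k) (P k)) *: P k.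
Proof.
case: (P_orth) => _ Porth Pneq0.
elim: m f => [|m IHm] f szf.
  by rewrite big_nil; apply/eqP; rewrite -size_poly_eq0 -leqn0.
set g := f - f`_m *: P m.
have szg : (size g <= m)%N by exact: size_sub_lead_scale.
have Bf k : B f (P k) = f`_m * B (P m) (P k) + B g (P k).
  by rewrite -B_linearl addrC subrK.
rewrite big_nat_recr //= Bf (orthogonal_lower_degree szg) // addr0.
rewrite mulfK // -[LHS](subrK (f`_m *: P m)) -/g [in LHS](IHm g szg).
congr (_ + _); apply: eq_big_nat => k /andP [_ lt_km].
by rewrite Bf (Porth m k) ?neq_ltn ?lt_km ?orbT // mulr0 add0r.
Qed.

(** A monic multiplier of degree j + 1 that is symmetric for B yields a
    recurrence with 2 j + 3 terms. *)
Lemma symmetric_multiplication_recurrence (phi : {poly K}) j :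
    (forall f g, B f g = B g f) ->
    (forall f g, B (phi * f) g = B f (phi * g)) ->
    phi \is monic -> size phi = j.+2 ->
  recurrence phi j P (fourier_coef B phi P).
Proof.
move=> Bsym Bphi mphi szphi n.
case: (P_orth) => Pms Porth _.
have szphiP k : size (phi * P k) = (k + j.+1).+1.
  rewrite size_monicM ?szphi ?monic_neq0 ?(Pms k).1 // (Pms k).2.
  by rewrite addnS (addnC k).
have leadphiP : (phi * P n)`_(n + j.+1) = 1.
  have := monicMl (P n) mphi; rewrite (Pms n).1 => /monicP.
  by rewrite /lead_coef szphiP.
set g := phi * P n - P (n + j.+1)%N.
have szg : (size g <= (n + j).+1)%N.
  rewrite -addnS; have := @size_sub_lead_scale (n + j.+1) (phi * P n).
  by rewrite leadphiP scale1r szphiP; apply.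
have Bg k : (k < (n + j).+1)%N -> B g (P k) = B (phi * P n) (P k).
  move=> ltk; rewrite -[phi * P n in RHS](subrK (P (n + j.+1)%N)) -/g addrC.
  rewrite -[P (n + _)%N]scale1r B_linearl Porth ?mulr0 ?add0r //.
  by rewrite neq_ltn addnS ltk orbT.
rewrite -[LHS](subrK (P (n + j.+1)%N)) -/g addrC; congr (_ + _).
have le_cut : (n - j.+1 <= (n + j).+1)%N.
  by rewrite (leq_trans (leq_subr _ _)) // ltnW // ltnS leq_addr.
rewrite [LHS](orthogonal_expansion szg) (big_cat_nat _ le_cut) //=.
rewrite big_nat big1 ?add0r => [|k /andP [_ ltk]].
  by apply: eq_big_nat => k /andP [_ ltk]; rewrite Bg.
(* For k < n - (j + 1) the degree k + j + 1 of phi P_k is less than n. *)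
rewrite Bg ?(leq_trans ltk) // Bphi Bsym.
rewrite (@orthogonal_lower_degree n) ?mul0r ?scale0r //.
by rewrite szphiP addnC -ltn_subRL.
Qed.

End OrthogonalExpansion.

Section SobolevForm.
Set Implicit Arguments.
Unset Strict Implicit.
Variable K : fieldType.

Lemma pochhammer_XsubC (a : K) k :
  pochhammer ('X - a%:P) k = \prod_(i < k) ('X - (a - i%:R)%:P).
Proof.
apply: eq_bigr => i _.
by rewrite polyCB opprB polyC_natr addrA addrAC.
Qed.

Lemma monic_pochhammer_XsubC (a : K) k : pochhammer ('X - a%:P) k \is monic.
Proof. by rewrite pochhammer_XsubC monic_prod_XsubC. Qed.

Lemma size_pochhammer_XsubC (a : K) k : size (pochhammer ('X - a%:P) k) = k.+1.
Proof.
by rewrite pochhammer_XsubC size_prod_XsubC -[index_enum _]enumT size_enum_ord.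
Qed.

Lemma horner_pochhammer_XsubC (a : K) k i :
  (i < k)%N -> (pochhammer ('X - a%:P) k).[a - i%:R] = 0.
Proof.
move=> lt_ik; rewrite pochhammer_XsubC horner_prod (bigD1 (Ordinal lt_ik)) //=.
by rewrite hornerXsubC subrr mul0r.
Qed.

Lemma iter_difference_eq0 (s : K) (T : (K -> K) -> K -> K) :
    (forall f x, f x = 0 -> f (x + s) = 0 -> T f x = 0) ->
  forall j f x, (forall i, (i <= j)%N -> f (x + s *+ i) = 0) ->
  iter j T f x = 0.
Proof.
move=> Tloc; elim=> [|j IHj] f x f0 /=.
  by rewrite -(f0 0%N) // mulr0n addr0.
apply: Tloc; apply: IHj => i le_ij; first exact/f0/leqW.
by rewrite -addrA -mulrS f0.
Qed.

Lemma iter_difference_linear (T : (K -> K) -> K -> K) :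
    (forall a f g, T (fun x => a * f x + g x) = fun x => a * T f x + T g x) ->
  forall j a (f g : {poly K}) x, iter j T (horner (a *: f + g)) x =
    a * iter j T (horner f) x + iter j T (horner g) x.
Proof.
move=> Tlin j a f g x.
suff -> : iter j T (horner (a *: f + g)) =
    fun y => a * iter j T (horner f) y + iter j T (horner g) y by [].
elim: j => [|j IHj] /=; last by rewrite IHj Tlin.
by apply: funext => y; rewrite hornerD hornerZ.
Qed.

(** The part of the argument common to both difference operators: s is the
    step of T, and the roots of phi include alpha, alpha + s, ...,
    alpha + j s. *)
Lemma sobolev_recurrence (u : {scalar {poly K}}) (T : (K -> K) -> K -> K)
    (s lambda alpha : K) j (phi : {poly K}) (P : nat -> {poly K}) :
    let B := sobolev_form u T lambda alpha j in
    (forall a f g, T (fun x => a * f x + g x) = fun x => a * T f x + T g x) ->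
    (forall f x, f x = 0 -> f (x + s) = 0 -> T f x = 0) ->
    phi \is monic -> size phi = j.+2 ->
    (forall i, (i <= j)%N -> phi.[alpha + s *+ i] = 0) ->
    monic_orthogonal B P ->
  recurrence phi j P (fourier_coef B phi P).
Proof.
move=> B Tlin Tloc mphi szphi phi0 Porth.
have Tphi f : iter j T (horner (phi * f)) alpha = 0.
  apply: (iter_difference_eq0 Tloc) => i /phi0 phii0.
  by rewrite hornerM phii0 mul0r.
apply: symmetric_multiplication_recurrence => //.
- move=> g a f1 f2; rewrite /B /sobolev_form (iter_difference_linear Tlin).
  by rewrite mulrDl -scalerAl linearP; ring.
- by move=> f g; rewrite /B /sobolev_form mulrC mulrAC.
- move=> f g; rewrite /B /sobolev_form !Tphi !mulr0 mul0r.
  by rewrite mulrCA mulrA.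
Qed.

End SobolevForm.

Theorem theorem5p4 (R : realType) (beta c : R[i]) (alpha lambda : R) (j : nat)
    (u : {scalar {poly R[i]}})
    (hc0 : c != 0) (hc1 : c != 1)
    (hbeta : forall k : nat, beta != - (k.+1)%:R)
    (halpha : alpha <= 0) (hlambda : 0 <= lambda)
    (hu : meixner_functional beta c u) :
  (forall P : nat -> {poly R[i]},
     let B := sobolev_form u (@backward_diff R[i]) lambda%:C alpha%:C j in
     let phi := pochhammer ('X - (alpha%:C)%:P) j.+1 in
     monic_orthogonal B P ->
     exists coef : nat -> nat -> R[i],
       recurrence phi j P coef /\
       (forall n k : nat, (n - j.+1 <= k < (n + j).+1)%N ->
          coef n k = fourier_coef B phi P n k)) /\
  (forall P : nat -> {poly R[i]},
     let B := sobolev_form u (@forward_diff R[i]) lambda%:C alpha%:C j in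
     let phi := pochhammer ('X - (alpha%:C)%:P - j%:R) j.+1 in
     monic_orthogonal B P ->
     exists coef : nat -> nat -> R[i],
       recurrence phi j P coef /\
       (forall n k : nat, (n - j.+1 <= k < (n + j).+1)%N ->
          coef n k = fourier_coef B phi P n k)).
Proof.
have linB (a : R[i]) f g :
    backward_diff (fun x => a * f x + g x) =
    fun x => a * backward_diff f x + backward_diff g x.
  by apply: funext => x; rewrite /backward_diff; ring.
have linF (a : R[i]) f g :
    forward_diff (fun x => a * f x + g x) =
    fun x => a * forward_diff f x + forward_diff g x.
  by apply: funext => x; rewrite /forward_diff; ring.
split=> P B phi Porth; exists (fourier_coef B phi P); split=> //.
- apply: (sobolev_recurrence (s := -1)) => //.
  + by move=> f x fx fx1; rewrite /backward_diff fx fx1 subrr.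
  + exact: monic_pochhammer_XsubC.
  + exact: size_pochhammer_XsubC.
  + by move=> i le_ij; rewrite mulNrn horner_pochhammer_XsubC.
- have phiE : phi = pochhammer ('X - (alpha%:C + j%:R)%:P) j.+1.
    by rewrite /phi polyCD polyC_natr opprD addrA.
  apply: (sobolev_recurrence (s := 1)) => //; rewrite ?phiE.
  + by move=> f x fx fx1; rewrite /forward_diff fx fx1 subrr.
  + exact: monic_pochhammer_XsubC.
  + exact: size_pochhammer_XsubC.
  + move=> i le_ij.
    (* alpha + i is the root of index j - i. *)
    have -> : alpha%:C + i%:R = alpha%:C + j%:R - (j - i)%:R :> R[i].
      by rewrite natrB //; ring.
    by rewrite horner_pochhammer_XsubC // ltnS leq_subr.
Qed.
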